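(* For every $n\geq 2$ and every $\epsilon>0$ there exist size cube packings $f_1,f_2,f_3:(0,1)\to[0,1]^n$ whose images $G_i=T(f_i)=\bigcup_{t\in(0,1)}\bigl(tK_{n-1}+f_i(t)\bigr)\subset\mathbb{R}^n$, $i=1,2,3$, satisfy $$\dim_{\mathrm{H}} G_1=n-1,\qquad \dim_{\mathrm{B}} G_2=n-\tfrac12,\qquad \dim_{\mathrm{A}} G_3\leq n-\tfrac12+\epsilon .$$ (In particular, the box dimension of $G_2$ exists.)
   Context: Let $K=[-0.5,0.5]^n\subset\mathbb{R}^n$ be the unit cube and $K_{n-1}=\partial K$ its topological boundary (the union of its $2n$ faces); all cubes are aligned with the coordinate axes. For $t>0$ and $x\in\mathbb{R}^n$, $tK_{n-1}+x=\{ty+x: y\in K_{n-1}\}$ is the boundary of the axis-parallel cube of side length $t$ centred at $x$. A size cube packing is any map $f:(0,1)\to[0,1]^n$; its image is $T(f)=\bigcup_{t\in(0,1)}(tK_{n-1}+f(t))$. $\dim_{\mathrm{H}}$ denotes Hausdorff dimension. For a set $F\subset\mathbb{R}^n$ and $r>0$, $N_r(F)$ is the minimal number of cubes of side length $r$ needed to cover $F$. The upper and lower box dimensions are the limsup and liminf as $r\to0$ of $-\log N_r(F)/\log r$; if they are equal, the common value is the box dimension $\dim_{\mathrm{B}}F$. The Assouad dimension is $$\dim_{\mathrm{A}}F=\inf\Bigl\{s\ge0:\ \exists C>0\ \forall R>0\ \forall r\in(0,R)\ \forall x\in F,\ N_r(B(x,R)\cap F)\le C(R/r)^s\Bigr\},$$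 where $B(x,R)$ is the closed ball of centre $x$ and radius $R$. *)

(* Defs.v *)
From mathcomp Require Import all_boot all_order all_algebra.
From mathcomp Require Import all_classical all_reals all_analysis.
Import Order.TTheory GRing.Theory Num.Theory.
Import numFieldNormedType.Exports.

Set Implicit Arguments.
Unset Strict Implicit.
Unset Printing Implicit Defensive.

Local Open Scope classical_set_scope.
Local Open Scope ring_scope.

(* The norm of 'rV[R]_n in the library is the sup norm, so the Euclidean
   distance, used below for balls and diameters, is defined separately. The
   topology on 'rV[R]_n is the usual one. *)
Definition eucl_dist (R : realType) (n : nat) (x y : 'rV[R]_n) : R :=
  Num.sqrt (\sum_(i < n) (x ord0 i - y ord0 i) ^+ 2).

Definition eclosed_ball (R : realType) (n : nat) (x : 'rV[R]_n) (rho : R) :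
    set 'rV[R]_n :=
  [set y | eucl_dist x y <= rho].

Definition topological_boundary (T : topologicalType) (A : set T) : set T :=
  closure A `\` A°.

Section Packings.
Variables (R : realType) (n : nat).

Definition unit_cube : set 'rV[R]_n :=
  [set x : 'rV[R]_n | forall i, - 2^-1 <= x ord0 i <= 2^-1].

(* t K_{n-1} + x, with K_{n-1} the boundary of the unit cube *)
Definition cube_boundary (t : R) (x : 'rV[R]_n) : set 'rV[R]_n :=
  [set t *: y + x | y in topological_boundary unit_cube].

(* A map (0,1) -> [0,1]^n is represented by a function on R whose values
   outside (0,1) are irrelevant. *)
Definition size_cube_packing (f : R -> 'rV[R]_n) : Prop :=
  forall t : R, 0 < t < 1 -> forall i, 0 <= f t ord0 i <= 1.

Definition packing_image (f : R -> 'rV[R]_n) : set 'rV[R]_n :=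
  \bigcup_(t in `]0, 1[) cube_boundary t (f t).

End Packings.

Section Dimensions.
Variables (R : realType) (n : nat).
Implicit Types (F U : set 'rV[R]_n) (s r : R).

Local Open Scope ereal_scope.

Definition ediam U : \bar R :=
  ereal_sup [set (eucl_dist x y)%:E | x in U & y in U].

(* |U|^s with the convention |set0|^s = 0 for every s, so that empty sets may
   pad countable covers into sequences, including when s = 0. *)
Definition diam_pow s U : \bar R :=
  if U == set0 then 0 else ediam U `^ s.

Definition hausdorff_premeasure s (delta : R) F : \bar R :=
  ereal_inf [set \sum_(0 <= k <oo) diam_pow s (U k) | U in
    [set U : nat -> set 'rV[R]_n |
      (forall k, ediam (U k) <= delta%:E) /\ F `<=` \bigcup_k U k]].

(* The premeasure is nonincreasing in delta: the supremum is the limit as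
   delta tends to 0. *)
Definition hausdorff_measure s F : \bar R :=
  ereal_sup [set hausdorff_premeasure s delta F | delta in [set d | (0 < d)%R]].

Definition hausdorff_dim F : \bar R :=
  ereal_inf [set s%:E | s in [set s | (0 <= s)%R /\ hausdorff_measure s F = 0]].

Definition cube (r : R) (c : 'rV[R]_n) : set 'rV[R]_n :=
  [set x : 'rV[R]_n |
    forall i, (c ord0 i - r / 2 <= x ord0 i <= c ord0 i + r / 2)%R].

(* N_r(F); equal to +oo when no finite family of cubes of side r covers F *)
Definition covering_number r F : \bar R :=
  ereal_inf [set m%:R%:E | m in
    [set m : nat | exists c : 'I_m -> 'rV[R]_n,
      F `<=` \bigcup_(j in [set: 'I_m]) cube r (c j)]].

Definition box_ratio F r : \bar R :=
  - (lne (covering_number r F) / (ln r)%:E).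

Definition upper_box_dim F : \bar R := limf_esup (box_ratio F) (0%R : R)^'+.

Definition lower_box_dim F : \bar R := limf_einf (box_ratio F) (0%R : R)^'+.

Definition has_box_dim F (d : \bar R) : Prop :=
  upper_box_dim F = d /\ lower_box_dim F = d.

Definition assouad_dim F : \bar R :=
  ereal_inf [set s%:E | s in [set s | (0 <= s)%R /\
    exists C : R, (0 < C)%R /\
      forall (rho r : R) (x : 'rV[R]_n),
        (0 < rho)%R -> (0 < r < rho)%R -> F x ->
        covering_number r (eclosed_ball x rho `&` F)
          <= (C * (rho / r) `^ s)%:E]].

End Dimensions.

(* Main.v *)
Require Import Defs.
From mathcomp Require Import all_boot all_order all_algebra.
From mathcomp Require Import finmap.
From mathcomp Require Import all_classical all_reals all_analysis.
From mathcomp Require Import zify ring lra.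
Import Order.TTheory GRing.Theory Num.Theory.
Import numFieldNormedType.Exports.
Local Open Scope ring_scope.

(** Centre the cube of side t at a point (g(t), ..., g(t)) of the diagonal. Its
    faces then lie on the hyperplanes on which some coordinate is a face height
    g(t) + t/2 or g(t) - t/2, so the image of the packing is contained in a
    union of n bounded parts of A x R^(n-1), up to the order of the coordinates,
    where A is the set of face heights. Essentially the only constraint on A is
    that its differences fill (0,1), and the dimension of the image is at most
    n - 1 + dim A for each of the three notions of dimension. It remains to find
    small sets A, one for the Hausdorff dimension and one for the two others.

    - For the box and Assouad dimensions, write t = x + 2x' where x collects the
      binary digits of t at even positions and 2x' those at odd positions. With
      face heights x + 1/2 and x - t + 1/2 the set A is made of two affine
      copies of the Cantor set of numbers with base 4 digits 0 and 1. That set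
      is described at scale 4^-k by the integers [spread k a], with a < 2^k,
      and [spread_gap] says that two of them differ by at least a multiple of
      the square of the difference of their indices. Hence an interval of length
      rho meets O(sqrt(rho/r)) pieces of size r ([digit_set_cover]), and a ball
      of radius rho in the image is covered by O((rho/r)^(n-1/2)) cubes of
      side r ([digit_image_cover]). This bounds the Assouad dimension, and the
      upper box dimension because the image is bounded. Conversely, the cubes
      with side t > 1/2 have upper faces at 2^k well separated heights, all of
      which contain one fixed (n-1)-dimensional cube up to translation along
      the first axis; counting grid points on these faces bounds the lower box
      dimension ([digit_image_separated]).

    - For the Hausdorff dimension, let A be the set of reals that lie, for every
      m, within a tiny distance of some rational. It is a countable intersection
      of dense open sets, so by Baire's theorem A - t/2 and A + t/2 have a common
      point g(t) in (0,1) ([exists_near_rat_pair]). The distances shrink fast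
      enough for covering each thin slab around a rational height by cubes of
      its own thickness to show that the s-dimensional measure of the image
      vanishes for all s > n - 1 ([near_rat_hausdorff_measure0]).

    The image of any packing contains a face of a cube, so its Hausdorff
    dimension is at least n - 1. This mass distribution argument is carried out
    by counting: a finite family of balls covering the compact face covers its
    grid points, and a ball of radius e meets O((e/r)^(n-1)) points of a grid of
    mesh r ([upper_face_ball_cover]). *)

(** * Spreading binary digits to base 4 *)

(** The number whose base 4 digits are the last k binary digits of a. These are
    the integers of the Moser-de Bruijn sequence. *)
Fixpoint spread (k a : nat) : nat :=
  if k is j.+1 then (4 * spread j a./2 + odd a)%N else 0%N.

Lemma spread1 k : spread k.+1 1 = 1%N.
Proof.
have spread0 j : spread j 0 = 0%N by elim: j => //= j ->.
by rewrite /= spread0.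
Qed.

(** A carry in a + b replaces two digits 1 by one digit 1 at the next position,
    and in base 4 the latter is worth more than the two former. *)
Lemma spread_superadditive k a b :
  (a + b < 2 ^ k)%N -> (spread k a + spread k b <= spread k (a + b))%N.
Proof.
elim: k a b => [|k IHk] a b //= ltab.
have ea := odd_double_half a; have eb := odd_double_half b.
rewrite expnS in ltab; rewrite halfD oddD.
case: (odd a) (odd b) ea eb => [] [] /= ea eb.
- have IH1 := IHk a./2 (1 + b./2)%N ltac:(lia).
  (* Two digits 1: pass through a./2 + (1 + b./2), as the carry is a unit. *)
  have IH2 := IHk 1%N b./2 ltac:(lia).
  case: k {IHk} ltab IH1 IH2 => [|k] ltab IH1 IH2; first by lia.
  rewrite spread1 in IH2; rewrite addnCA in IH1.
  by lia.
- by have := IHk a./2 b./2 ltac:(lia); rewrite add0n; lia.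
- by have := IHk a./2 b./2 ltac:(lia); rewrite add0n; lia.
- by have := IHk a./2 b./2 ltac:(lia); rewrite add0n; lia.
Qed.

(** The linear term makes the induction on the number of digits go through. *)
Lemma spread_quadratic k a :
  (a < 2 ^ k)%N -> (a ^ 2 + 2 * a <= 3 * spread k a)%N.
Proof.
elim: k a => [|k IHk] a /= lta; first by have -> : a = 0%N by lia.
rewrite expnS in lta; have ea := odd_double_half a.
have := IHk a./2 ltac:(lia).
rewrite -!mulnn; case: (odd a) ea => /= ea IH; nia.
Qed.

(** A quantitative strict monotonicity: this is why an interval of length L
    contains only O(sqrt L) values of [spread]. *)
Lemma spread_gap k a b : (a <= b < 2 ^ k)%N ->
  ((b - a) ^ 2 + 2 * (b - a) + 3 * spread k a <= 3 * spread k b)%N.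
Proof.
move=> /andP[leab ltb].
have := spread_superadditive k a (b - a)%N ltac:(lia).
have := spread_quadratic k (b - a)%N ltac:(lia).
by rewrite subnKC //; lia.
Qed.

(** The bits of N at even and at odd positions, each read as a binary number;
    together they invert (a, b) |-> spread a + 2 spread b. *)
Fixpoint even_bits (k N : nat) : nat :=
  if k is j.+1 then (2 * even_bits j (N %/ 4) + odd N)%N else 0%N.

Fixpoint odd_bits (k N : nat) : nat :=
  if k is j.+1 then (2 * odd_bits j (N %/ 4) + odd N./2)%N else 0%N.

Lemma even_bits_lt k N : (even_bits k N < 2 ^ k)%N.
Proof.
elim: k N => //= k IHk N; rewrite expnS.
by have := IHk (N %/ 4)%N; case: (odd N); lia.
Qed.

Lemma odd_bits_lt k N : (odd_bits k N < 2 ^ k)%N.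
Proof.
elim: k N => //= k IHk N; rewrite expnS.
by have := IHk (N %/ 4)%N; case: (odd N./2); lia.
Qed.

Lemma even_bits_spread k a b : (a < 2 ^ k)%N ->
  even_bits k (spread k a + 2 * spread k b) = a.
Proof.
elim: k a b => [|k IHk] a b lta /=; first by move: lta; rewrite expn0; lia.
rewrite expnS in lta.
have -> : ((4 * spread k a./2 + odd a + 2 * (4 * spread k b./2 + odd b)) %/ 4
  = spread k a./2 + 2 * spread k b./2)%N by case: (odd a); case: (odd b); lia.
rewrite IHk; last by lia.
rewrite (_ : odd _ = odd a); last by case: (odd a); case: (odd b); lia.
by have := odd_double_half a; lia.
Qed.

Lemma bitsK k N : (N < 4 ^ k)%N ->
  (spread k (even_bits k N) + 2 * spread k (odd_bits k N) = N)%N.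
Proof.
elim: k N => [|k IHk] N ltN /=; first by move: ltN; rewrite expn0; lia.
rewrite expnS in ltN.
have E x (c : bool) : odd (2 * x + c) = c by case: c; lia.
have H x (c : bool) : (2 * x + c)./2 = x by case: c; lia.
rewrite !E !H.
have := IHk (N %/ 4)%N ltac:(lia).
have := odd_double_half N; have := odd_double_half N./2.
by lia.
Qed.

Lemma spread_pow2 k : spread k.+1 (2 ^ k) = (4 ^ k)%N.
Proof.
elim: k => [|k IHk]; first by rewrite spread1.
rewrite [LHS]/= -[X in (4 * X + _)%N]/(spread k.+1 (2 ^ k.+1)./2).
by rewrite expnS mul2n doubleK IHk odd_double addn0 [RHS]expnS.
Qed.

Lemma spread_lt k a : (a < 2 ^ k)%N -> (3 * spread k a < 4 ^ k)%N.
Proof.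
elim: k a => [|k IHk] a /= lta //; rewrite expnS in lta; rewrite expnS.
have := IHk a./2 ltac:(lia); case: (odd a); lia.
Qed.

(** * The even-position binary digits of a real number *)

Section EvenPart.
Context {R : realType}.
Implicit Types (t : R) (k : nat).

Definition base4 k t : nat := Num.truncn (4 ^+ k * t).

Definition even_trunc k t : R :=
  (spread k (even_bits k (base4 k t)))%:R / 4 ^+ k.

(** The sum of b_(2j) / 4^j, where b_i is the binary digit of t of weight 2^-i, as
    the supremum of its partial sums. *)
Definition even_part t : R := sup (range (even_trunc ^~ t)).

Lemma base4_itv k t : 0 < t ->
  (base4 k t)%:R <= 4 ^+ k * t < (base4 k t)%:R + 1.
Proof. by move=> t0; rewrite natr1 truncn_itv // mulr_ge0 // ltW. Qed.

Lemma base4S k t : 0 < t -> base4 k t = (base4 k.+1 t %/ 4)%N.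
Proof.
move=> t0; have /andP[l1 l2] := base4_itv k t t0.
have /andP[m1 m2] := base4_itv k.+1 t t0.
move: m1 m2; rewrite exprS => m1 m2.
set N := base4 k t in l1 l2 *; set M := base4 k.+1 t in m1 m2 *.
have h1 : (4 * N < M.+1)%N by rewrite -(ltr_nat R) natrM -natr1; lra.
have h2 : (M < 4 * N.+1)%N by rewrite -(ltr_nat R) natrM -natr1; lra.
by lia.
Qed.

Lemma base4_lt k t : 0 < t < 1 -> (base4 k t < 4 ^ k)%N.
Proof.
move=> /andP[t0 t1]; have /andP[l1 _] := base4_itv k t t0.
by rewrite -(ltr_nat R) (le_lt_trans l1)// natrX gtr_pMr// exprn_gt0.
Qed.

Lemma even_truncS k t : 0 < t ->
  even_trunc k t <= even_trunc k.+1 t <= even_trunc k t + (4 ^+ k.+1)^-1.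
Proof.
move=> t0; rewrite /even_trunc /=.
rewrite -base4S//; set a := even_bits k _; set e := odd _.
rewrite (_ : (2 * a + e)./2 = a); last by case: e; lia.
rewrite (_ : odd (2 * a + e) = e); last by case: e; lia.
rewrite natrD natrM exprS; set q := 4 ^+ k; set s := (spread k a)%:R.
have q0 : 0 < q by rewrite exprn_gt0.
rewrite -(_ : 4 * s / (4 * q) = s / q); last by field; rewrite gt_eqF.
have q40 : 0 < (4 * q)^-1 by rewrite invr_gt0 mulr_gt0.
by case: e => /=; rewrite mulrDl; lra.
Qed.

(** The digits of t beyond position k add at most 4^-(k+1) + 4^-(k+2) + ... =
    4^-k / 3, so these truncations squeeze their supremum. *)
Lemma even_trunc_le k j t : 0 < t ->
  even_trunc k t <= even_trunc (k + j) t /\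
  even_trunc (k + j) t + (3 * 4 ^+ (k + j))^-1
    <= even_trunc k t + (3 * 4 ^+ k)^-1.
Proof.
move=> t0; elim: j => [|j [IH1 IH2]]; first by rewrite addn0; split.
have /andP[h1 h2] := even_truncS (k + j) t t0.
rewrite addnS; split; first by rewrite (le_trans IH1).
apply: le_trans IH2; move: h2; rewrite exprS; set q := 4 ^+ _.
have q0 : 0 < q by rewrite exprn_gt0.
rewrite (_ : (3 * (4 * q))^-1 = (12 * q)^-1); last by rewrite mulrA -natrM.
have -> : (4 * q)^-1 = 3 * (12 * q)^-1 by field; rewrite gt_eqF.
have -> : (3 * q)^-1 = 4 * (12 * q)^-1 by field; rewrite gt_eqF.
lra.
Qed.

Lemma even_part_itv k t : 0 < t ->
  even_trunc k t <= even_part t <= even_trunc k t + (3 * 4 ^+ k)^-1.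
Proof.
move=> t0.
have ub : ubound (range (even_trunc ^~ t)) (even_trunc k t + (3 * 4 ^+ k)^-1).
  move=> _ [j _ <-]; have [jk|/ltnW kj] := leqP j k.
    have [h _] := even_trunc_le j (k - j) t t0; rewrite subnKC// in h.
    by rewrite (le_trans h)// lerDl invr_ge0 mulr_ge0.
  have [_] := even_trunc_le k (j - k) t t0; rewrite subnKC//; apply: le_trans.
  by rewrite lerDl invr_ge0 mulr_ge0.
apply/andP; split.
  by apply: ub_le_sup; [exists (even_trunc k t + (3 * 4 ^+ k)^-1) | exists k].
by apply: ge_sup => //; exists (even_trunc k t); exists k.
Qed.

Lemma even_part_scaled k t : 0 < t ->
  (spread k (even_bits k (base4 k t)))%:R <= 4 ^+ k * even_part t
    <= (spread k (even_bits k (base4 k t)))%:R + 3^-1.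
Proof.
move=> t0; have /andP[] := even_part_itv k t t0.
rewrite /even_trunc; set s := _%:R; set q := 4 ^+ k => h1 h2.
have q0 : 0 < q by rewrite exprn_gt0.
rewrite ler_pdivrMr// mulrC in h1; rewrite h1 /=.
rewrite -(ler_pM2l q0) in h2; apply: le_trans h2 _.
by rewrite le_eqVlt; apply/orP; left; apply/eqP; field; rewrite gt_eqF.
Qed.

Lemma even_part_bounds t : 0 < t -> 0 <= even_part t <= 3^-1.
Proof. by move=> t0; have := even_part_scaled 0 t t0; rewrite /= expr0 mul1r add0r. Qed.

(** Approximations of x and of t - x at scale 4^-k by multiples of spread
    values: these say that both face heights of a cube lie in affine copies of
    one Cantor set. *)
Lemma even_part_digits t k : 0 < t < 1 ->
  exists2 a, (a < 2 ^ k)%N & `|4 ^+ k * even_part t - (spread k a)%:R| <= 1.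
Proof.
move=> /andP[t0 _]; exists (even_bits k (base4 k t)); first exact: even_bits_lt.
have /andP[h1 h2] := even_part_scaled k t t0.
by rewrite ler_norml; lra.
Qed.

Lemma odd_part_digits t k : 0 < t < 1 ->
  exists2 a, (a < 2 ^ k)%N &
    `|4 ^+ k * (t - even_part t) - 2 * (spread k a)%:R| <= 1.
Proof.
move=> t01; have /andP[t0 _] := t01.
exists (odd_bits k (base4 k t)); first exact: odd_bits_lt.
have /andP[h1 h2] := even_part_scaled k t t0.
have /andP[l1 l2] := base4_itv k t t0.
have := bitsK k _ (base4_lt k t t01) => /(congr1 (fun m => m%:R : R)).
rewrite natrD natrM => E; rewrite -E in l1 l2.
by rewrite ler_norml mulrBr; lra.
Qed.

(** All patterns of even digits occur already for t in (1/2, 1): take the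
    leading odd-position digit of t to be 1 and the next ones to be 0. Adding half
    a unit in the last place makes the inequality 1/2 < t strict. *)
Lemma even_part_surj k a : (a < 2 ^ k.+1)%N ->
  exists t : R, [/\ 2^-1 < t, t < 1 &
    (spread k.+1 a)%:R <= 4 ^+ k.+1 * even_part t
      <= (spread k.+1 a)%:R + 3^-1].
Proof.
move=> lta; have sa := spread_lt _ _ lta; have sb := spread_pow2 k.
pose N := (spread k.+1 a + 2 * spread k.+1 (2 ^ k))%N.
set q : R := 4 ^+ k.+1.
have q0 : 0 < q by rewrite exprn_gt0.
pose t : R := (N%:R + 2^-1) / q.
have EN : q * t = N%:R + 2^-1 by rewrite /t; field; rewrite gt_eqF.
have h1 : (2 * N >= 4 ^ k.+1)%N by rewrite /N sb expnS; lia.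
have h2 : (N < 4 ^ k.+1)%N by rewrite /N sb; move: sa; rewrite expnS; lia.
have qE : q = (4 ^ k.+1)%:R by rewrite natrX.
have h1' : q <= 2 * N%:R by rewrite qE -natrM ler_nat.
have h2' : N%:R + 1 <= q by rewrite qE natr1 ler_nat.
have t2 : 2^-1 < t by rewrite /t ltr_pdivlMr//; lra.
have t1 : t < 1 by rewrite /t ltr_pdivrMr//; lra.
exists t; split => //; have t0 : 0 < t by rewrite (lt_trans _ t2).
have bE : base4 k.+1 t = N.
  by apply: truncn_def; rewrite -/q EN -[N.+1%:R]natr1; apply/andP; split; lra.
by have := even_part_scaled k.+1 t t0; rewrite bE /N even_bits_spread.
Qed.

End EvenPart.

(** * Coverings by cubes and separated points *)

Local Open Scope classical_set_scope.
Local Open Scope ring_scope.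

Section Coverings.
Context {R : realType} {n : nat}.
Implicit Types (F : set 'rV[R]_n) (r L : R) (m : nat).

(** A sequence of centres, rather than a family indexed by ordinals, makes unions
    and products of coverings easy to form. *)
Definition coverable r m F := exists s : seq 'rV[R]_n,
  (size s <= m)%N /\ forall x, F x -> exists2 c, c \in s & cube r c x.

Lemma covering_number_le r m F :
  coverable r m F -> (covering_number r F <= m%:R%:E)%E.
Proof.
move=> [s [sm cov]]; apply: (@le_trans _ _ (size s)%:R%:E); last first.
  by rewrite lee_fin ler_nat.
apply: ereal_inf_lbound; exists (size s) => //.
exists (fun j => nth 0 s j) => x /cov[c cs xc].
have ics : (index c s < size s)%N by rewrite index_mem.
by exists (Ordinal ics) => //=; rewrite nth_index.
Qed.

Lemma covering_number_ge r k F :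
  (forall m, coverable r m F -> (k <= m)%N) ->
  (k%:R%:E <= covering_number r F)%E.
Proof.
move=> H; apply: le_ereal_inf_tmp => _ [m [c cov] <-].
rewrite lee_fin ler_nat; apply: H.
exists [seq c j | j <- enum 'I_m]; split.
  by rewrite size_map size_enum_ord.
move=> x /cov[j _ xj]; exists (c j) => //.
by apply/mapP; exists j => //; rewrite mem_enum.
Qed.

Lemma coverable_sub r m m' F F' : (m <= m')%N -> F `<=` F' ->
  coverable r m F' -> coverable r m' F.
Proof.
move=> mm' FF' [s [sm cov]]; exists s; split; first exact: leq_trans mm'.
by move=> x /FF'; exact: cov.
Qed.

Lemma coverable_bigcup r (I : eqType) (D : seq I) (F : I -> set 'rV[R]_n)
    (m : I -> nat) :
  (forall i, i \in D -> coverable r (m i) (F i)) ->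
  coverable r (\sum_(i <- D) m i) (\bigcup_(i in [set` D]) F i).
Proof.
elim: D => [|i D IHD] H.
  by exists [::]; rewrite big_nil; split => // x [].
have [s [sm cov]] := H i (mem_head _ _).
have [|s' [sm' cov']] := IHD; first by move=> j jD; apply: H; rewrite inE jD orbT.
exists (s ++ s'); split; first by rewrite big_cons size_cat leq_add.
move=> x [j /=]; rewrite inE => /predU1P[-> /cov[c cs xc]|jD Fj].
  by exists c => //; rewrite mem_cat cs.
by have [|c cs xc] := cov' x; [exists j|exists c => //; rewrite mem_cat cs orbT].
Qed.

(** The centres are all the points whose i-th coordinate is taken from cs i. *)
Lemma coverable_product r (cs : 'I_n -> seq R) F :
  (forall x, F x -> forall i, exists2 c, c \in cs i & `|x ord0 i - c| <= r / 2) ->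
  coverable r (\prod_i size (cs i)) F.
Proof.
(* Ordinals below a common bound M index all the sequences at once. *)
move=> H; pose M := (\max_i size (cs i)).+1.
have cardlt k : (k <= M)%N -> #|[pred j : 'I_M | (j < k)%N]| = k.
  move=> kM; rewrite -sum1_card -(big_ord_widen _ (fun=> 1%N) kM).
  by rewrite sum_nat_const card_ord muln1.
pose P (i : 'I_n) := [pred j : 'I_M | (j < size (cs i))%N].
exists [seq \row_i nth 0 (cs i) (h i) | h : {ffun 'I_n -> 'I_M} in family P].
split.
  rewrite size_image card_family foldrE big_map big_enum /=.
  rewrite leq_eqVlt; apply/orP; left; apply/eqP; apply: eq_bigr => i _.
  by rewrite cardlt // leqW// (leq_bigmax i).
move=> x Fx.
have idx i : exists j : 'I_M,
    (j < size (cs i))%N /\ `|x ord0 i - nth 0 (cs i) j| <= r / 2.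
  have [c ccs xc] := H x Fx i.
  have jM : (index c (cs i) < M)%N.
    by rewrite (leq_trans _ (leqW (leq_bigmax i)))// index_mem.
  by exists (Ordinal jM) => /=; rewrite index_mem nth_index.
have [h Hh] := choice idx.
exists (\row_i nth 0 (cs i) (h i)).
  apply/fintype.imageP; exists [ffun i => h i].
    by apply/familyP => i; rewrite ffunE inE (Hh i).1.
  by apply/rowP => i; rewrite !mxE ffunE.
move=> i; rewrite mxE; have [_] := Hh i; rewrite ler_norml => /andP[h1 h2].
by apply/andP; split; lra.
Qed.

(** A cube of side r contains at most one point of an r-separated family. *)
Lemma separated_leq_cover r m F (T : finType) (p : T -> 'rV[R]_n) :
  (forall t, F (p t)) ->
  (forall t t', t != t' -> exists i, r < `|p t ord0 i - p t' ord0 i|) ->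
  coverable r m F -> (#|T| <= m)%N.
Proof.
move=> Fp sep [s [sm cov]]; apply: leq_trans sm.
have [c Hc] := choice (fun t => let: ex_intro2 c cs xc := cov _ (Fp t) in
  ex_intro (fun c => c \in s /\ cube r c (p t)) c (conj cs xc)).
have ics t : (index (c t) s < size s)%N by rewrite index_mem (Hc t).1.
have inj : injective (fun t => Ordinal (ics t)).
  move=> t t' [] /(congr1 (nth 0 s)); rewrite !nth_index ?(Hc _).1// => E.
  apply/eqP; apply: contraT => /sep[i].
  have [_ /(_ i) /andP[a1 a2]] := Hc t; have [_ /(_ i) /andP[b1 b2]] := Hc t'.
  rewrite E in a1 a2; rewrite real_ltNge ?num_real// => /negP[].
  by rewrite ler_norml; apply/andP; split; lra.
by have := leq_card _ inj; rewrite card_ord.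
Qed.

Definition interval_centres r L u : seq R :=
  [seq u - L + (j%:R + 2^-1) * r | j <- iota 0 (Num.truncn (2 * L / r)).+1].

Lemma interval_centresP r L u x : 0 < r -> `|x - u| <= L ->
  exists2 c, c \in interval_centres r L u & `|x - c| <= r / 2.
Proof.
move=> r0; rewrite ler_norml => /andP[x1 x2].
have y0 : 0 <= (x - u + L) / r by apply: divr_ge0 (ltW r0); lra.
have /andP[j1 j2] := truncn_itv y0; set j := Num.truncn _ in j1 j2.
exists (u - L + (j%:R + 2^-1) * r).
  apply/mapP; exists j => //; rewrite mem_iota /= add0n ltnS.
  by apply: le_truncn; rewrite ler_pM2r ?invr_gt0//; lra.
rewrite ler_pdivlMr// in j1; rewrite ltr_pdivrMr// -natr1 mulrDl in j2.
by rewrite ler_norml mulrDl; apply/andP; split; lra.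
Qed.

(** The form in which products are used: one coordinate has few possible centres
    and the remaining n - 1 are only known to lie in an interval. *)
Lemma coverable_slab r L (u : 'rV[R]_n) (i : 'I_n) (cs : seq R) F : 0 < r ->
  (forall x, F x -> forall j, `|x ord0 j - u ord0 j| <= L) ->
  (forall x, F x -> exists2 c, c \in cs & `|x ord0 i - c| <= r / 2) ->
  coverable r (size cs * (Num.truncn (2 * L / r)).+1 ^ n.-1) F.
Proof.
move=> r0 FL Fi.
pose cs' j := if j == i then cs else interval_centres r L (u ord0 j).
apply: (@coverable_sub _ (\prod_j size (cs' j)) _ _ F) => //.
  rewrite (bigD1 i)//= {1}/cs' eqxx leq_eqVlt; apply/orP; left; apply/eqP.
  congr (_ * _)%N; rewrite (eq_bigr (fun=> (Num.truncn (2 * L / r)).+1)).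
    by rewrite prod_nat_const cardC1 card_ord.
  by move=> j /negbTE ji; rewrite /cs' ji size_map size_iota.
apply: coverable_product => x Fx j; rewrite /cs'.
by have [->|_] := eqVneq j i; [exact: Fi|apply: interval_centresP => //; exact: FL].
Qed.

End Coverings.

(** * The boundary of a cube *)

Section CubeBoundary.
Context {R : realType} {n : nat}.
Implicit Types (t r : R) (x y : 'rV[R]_n).

Lemma rV_ballE x r y : 0 < r ->
  ball x r y <-> forall i, `|x ord0 i - y ord0 i| < r.
Proof.
move=> r0; split=> [[_ h] i|h]; first exact: (h ord0 i).
by split=> // i j; rewrite (ord1 i); exact: h.
Qed.

(** A point with all coordinates below 1/2 in absolute value has a sup-norm
    neighbourhood inside the cube, and a point with a coordinate of absolute
    value 1/2 leaves the cube when it is slightly dilated. *)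
Lemma unit_cube_boundaryP y : topological_boundary (@unit_cube R n) y <->
  (forall i, `|y ord0 i| <= 2^-1) /\ exists i, `|y ord0 i| = 2^-1.
Proof.
split=> [[cly inty]|[yle [i yi]]].
  have yle i : `|y ord0 i| <= 2^-1.
    rewrite leNgt; apply/negP => yi.
    pose e := `|y ord0 i| - 2^-1; have e0 : 0 < e by rewrite subr_gt0.
    have [z [/(_ i) zc /(rV_ballE _ _ _ e0) /(_ i)]] :=
      cly (ball y e) (nbhsx_ballx y e e0).
    rewrite -ler_norml in zc; have := ler_normB (y ord0 i - z ord0 i) (- z ord0 i).
    by rewrite opprK subrK normrN /e; lra.
  split => //; apply: contrapT => noteq; apply: inty.
  have ylt i : `|y ord0 i| < 2^-1.
    by rewrite lt_neqAle yle andbT; apply/eqP => E; apply: noteq; exists i.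
  pose e := \big[Order.min/1]_i (2^-1 - `|y ord0 i|).
  have e0 : 0 < e.
    by rewrite lt_bigmin// => i _; rewrite subr_gt0.
  apply/nbhs_ballP; exists e => //= z /(rV_ballE _ _ _ e0) yz i.
  rewrite -ler_norml; have := ler_normB (y ord0 i) (y ord0 i - z ord0 i).
  rewrite subKr; have := yz i; have : e <= 2^-1 - `|y ord0 i| by exact: bigmin_le_cond.
  lra.
split.
  move=> B /nbhs_singleton By; exists y; split => //.
  by move=> j; rewrite -ler_norml.
move=> /nbhs_ballP[e /= e0 ye].
pose z : 'rV[R]_n := (1 + e) *: y.
have /ye/(_ i) : ball y e z.
  apply/rV_ballE => // j; rewrite mxE mulrDl mul1r opprD addNKr normrN normrM.
  have := yle j; rewrite gtr0_norm//; nra.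
by rewrite -ler_norml mxE normrM yi gtr0_norm; lra.
Qed.

Lemma cube_boundaryP t x y : 0 < t -> cube_boundary t x y <->
  (forall i, `|y ord0 i - x ord0 i| <= t / 2) /\
  exists i, `|y ord0 i - x ord0 i| = t / 2.
Proof.
move=> t0; split.
  move=> [z /unit_cube_boundaryP[zle [i zi]] <-].
  split => [j|]; last exists i; rewrite !mxE addrK normrM gtr0_norm//.
    by rewrite ler_pM2l.
  by rewrite zi.
move=> [yle [i yi]]; exists (t^-1 *: (y - x)); last first.
  by rewrite scalerA divff ?gt_eqF// scale1r subrK.
apply/unit_cube_boundaryP; split => [j|]; last exists i;
  rewrite !mxE normrM gtr0_norm ?invr_gt0//.
  by rewrite ler_pdivrMl.
by rewrite yi mulKf ?gt_eqF.
Qed.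

End CubeBoundary.

(** * Covering the Cantor set of base 4 digits 0 and 1 *)

Section DigitSet.
Context {R : realType}.
Implicit Types (u r rho sigma : R) (k a : nat).

(** A description, scale by scale, of the dilation by sigma of the Cantor set of
    numbers with base 4 digits 0 and 1. *)
Definition digit_set sigma : set R := [set u | forall k,
  exists2 a, (a < 2 ^ k)%N & `|4 ^+ k * u - sigma * (spread k a)%:R| <= 1].

(** The least l with 2 * 4^-l <= r. Then intervals of radius 4^-l fit in
    intervals of length r, and by minimality 4^l is comparable to 1/r unless
    l = 0. *)
Lemma exists_scale r : 0 < r ->
  exists l, 2 <= 4 ^+ l * r /\ (l = 0%N \/ 4 ^+ l * r < 8).
Proof.
move=> r0.
have ex : exists l, 2 <= 4 ^+ l * r.
  exists (Num.truncn (2 / r)).+1; rewrite -ler_pdivrMr//.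
  rewrite (le_trans (ltW (truncnS_gt _)))// -natrX ler_nat.
  by apply: ltnW; exact: ltn_expl.
case: (ex_minnP ex) => [[|l] hl lmin]; first by exists 0%N; split => //; left.
exists l.+1; split => //; right; rewrite ltNge; apply/negP => h8.
have /lmin : 2 <= 4 ^+ l * r by move: h8; rewrite exprS; lra.
by rewrite ltnn.
Qed.

(** At the scale l of [exists_scale], let a0 be the least index of a piece of the
    Cantor set that meets the interval. By [spread_gap] the index of any other
    such piece exceeds a0 by O(sqrt(rho/r)), so the pieces with these indices are
    enough. When l = 0 there is just one piece. *)
Lemma digit_set_cover sigma u0 r rho : 1 <= `|sigma| -> 0 < r -> r < rho ->
  exists cs : seq R, (size cs)%:R <= 9 * Num.sqrt (rho / r) /\
    forall u, digit_set sigma u -> `|u - u0| <= rho ->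
      exists2 c, c \in cs & `|u - c| <= r / 2.
Proof.
move=> sigma1 r0 rrho; have rho0 : 0 < rho by apply: lt_trans rrho.
have rr1 : 1 < rho / r by rewrite ltr_pdivlMr// mul1r.
set S := Num.sqrt (rho / r).
have S1 : 1 <= S by rewrite -sqrtr1 ler_wsqrtr// ltW.
have SS : S ^+ 2 = rho / r by rewrite sqr_sqrtr// ltW// (lt_trans _ rr1).
have [l [lr l8]] := exists_scale r r0.
have q0 : 0 < (4 ^+ l : R) by rewrite exprn_gt0.
pose near a := (a < 2 ^ l)%N /\ exists u, [/\ digit_set sigma u, `|u - u0| <= rho &
  `|4 ^+ l * u - sigma * (spread l a)%:R| <= 1].
have [ex|nex] := pselect (exists a, near a); last first.
  exists [::]; split; first by rewrite mulr_ge0 // (le_trans _ S1).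
  move=> u Du uu0; exfalso; apply: nex.
  by have [a al ua] := Du l; exists a; split => //; exists u; split.
have {}ex : exists a, `[< near a >] by case: ex => a na; exists a; apply/asboolP.
case: (ex_minnP ex) => a0 /asboolP[a0l [v [Dv vu0 va0]]] a0min.
exists [seq sigma * (spread l (a0 + i))%:R / 4 ^+ l |
    i <- iota 0 (Num.truncn (8 * S)).+1].
split.
  rewrite size_map size_iota -natr1.
  have : (Num.truncn (8 * S))%:R <= 8 * S.
    by rewrite truncn_le mulr_ge0// (le_trans _ S1).
  lra.
move=> u Du uu0; have [a al ua] := Du l.
have na : near a by split => //; exists u.
have a0a : (a0 <= a)%N by apply: a0min; apply/asboolP.
have a0a_lt : (a0 <= a < 2 ^ l)%N by rewrite a0a.
exists (sigma * (spread l a)%:R / 4 ^+ l); last first.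
  have -> : u - sigma * (spread l a)%:R / 4 ^+ l =
      (4 ^+ l * u - sigma * (spread l a)%:R) / 4 ^+ l.
    by field; rewrite gt_eqF.
  rewrite normrM normfV (gtr0_norm q0) ler_pdivrMr//.
  by apply: le_trans ua _; lra.
apply/mapP; exists (a - a0)%N; last by rewrite subnKC.
rewrite mem_iota /= add0n ltnS truncn_ge_nat; last first.
  by rewrite mulr_ge0// (le_trans _ S1).
have [l0|lpos] := l8.
  have -> : a = 0%N by apply/eqP; rewrite -leqn0 -ltnS; move: al; rewrite l0.
  rewrite sub0n.
  by rewrite mulr_ge0// (le_trans _ S1).
set m := (a - a0)%N; pose s : R := (spread l a)%:R; pose s0 : R := (spread l a0)%:R.
have ms : (m%:R : R) ^+ 2 + 3 * s0 <= 3 * s.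
  rewrite -natrX -!natrM -natrD ler_nat.
  by apply: leq_trans (spread_gap l a0 a a0a_lt); rewrite leq_add2r leq_addr.
have m0 : 0 <= (m%:R : R) ^+ 2 by rewrite sqr_ge0.
(* u and v are at distance at most 2 rho, and each is within 4^-l of its piece. *)
have ss : s - s0 <= 2 + 2 * (4 ^+ l * rho).
  apply: (@le_trans _ _ (`|sigma| * `|s - s0|)).
    by rewrite (le_trans (ler_norm _))// ler_peMl.
  rewrite -normrM mulrBr.
  have uv : `|4 ^+ l * u - 4 ^+ l * v| <= 2 * (4 ^+ l * rho).
    rewrite -mulrBr normrM gtr0_norm// mulrCA ler_pM2l//.
    move: uu0 vu0; rewrite !ler_norml => /andP[? ?] /andP[? ?].
    by apply/andP; split; lra.
  move: ua va0 uv; rewrite -/s -/s0 !ler_norml.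
  by move=> /andP[? ?] /andP[? ?] /andP[? ?]; apply/andP; split; lra.
have l9 : 4 ^+ l * rho <= 8 * S ^+ 2.
  by rewrite SS mulrA ler_pdivlMr// mulrAC ler_pM2r// ltW.
rewrite -ler_sqr ?nnegrE ?ler0n//; last by rewrite mulr_ge0// (le_trans _ S1).
have S21 : 1 <= S ^+ 2 by rewrite SS ltW.
by rewrite exprMn; lra.
Qed.

End DigitSet.

(** * The digit packing and its Assouad dimension *)

Section DigitPacking.
Context {R : realType}.

Lemma eucl_dist_coord n (x y : 'rV[R]_n) i :
  `|x ord0 i - y ord0 i| <= eucl_dist x y.
Proof.
rewrite -sqrtr_sqr ler_wsqrtr// (bigD1 i)//= lerDl sumr_ge0// => j _.
exact: sqr_ge0.
Qed.

Lemma eucl_dist_le n (x y : 'rV[R]_n) r :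
  (forall i, `|x ord0 i - y ord0 i| <= r) -> 0 <= r ->
  eucl_dist x y <= n%:R * r.
Proof.
move=> h r0; rewrite -[leRHS]ger0_norm ?mulr_ge0// -sqrtr_sqr ler_wsqrtr//.
apply: (@le_trans _ _ (\sum_(i < n) r ^+ 2)).
  by apply: ler_sum => i _; rewrite -real_normK ?num_real// lerXn2r ?nnegrE.
rewrite sumr_const card_ord -[_ ^+ 2 *+ n]mulr_natl exprMn.
apply: ler_wpM2r; first exact: sqr_ge0.
by rewrite -natrX ler_nat; case: (n) => // m; rewrite -mulnn leq_pmulr.
Qed.

(** With this centre, the face heights are x + 1/2 and x - t + 1/2 where x is the
    even part of t; the shift by 1/2 keeps the centre in the unit cube. *)
Definition digit_packing n (t : R) : 'rV[R]_n :=
  \row_i (even_part t - t / 2 + 2^-1).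

Lemma digit_packing_size n : size_cube_packing (digit_packing n).
Proof.
move=> t /andP[t0 t1] i; rewrite mxE.
by have /andP[h1 h2] := even_part_bounds t t0; apply/andP; split; lra.
Qed.

Lemma packing_imageP n (f : R -> 'rV[R]_n) y :
  packing_image f y <-> exists t, 0 < t < 1 /\ cube_boundary t (f t) y.
Proof.
split => [[t /=]|[t [t01 ty]]]; first by rewrite in_itv /= => t01 ty; exists t.
by exists t => //=; rewrite in_itv.
Qed.

Lemma digit_image_coord n (y : 'rV[R]_n) : packing_image (digit_packing n) y ->
  exists i (b : bool), digit_set (if b then 1 else - 2) (y ord0 i - 2^-1).
Proof.
move=> /packing_imageP[t [t01 ty]]; have /andP[t0 t1] := t01.
have [_ [i]] := (cube_boundaryP t _ y t0).1 ty; rewrite mxE.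
set e := y ord0 i - _; have [e0|e0] := ger0P e => E; exists i.
  exists true => k; have [a al ha] := even_part_digits t k t01.
  exists a => //; rewrite mul1r; rewrite (_ : y ord0 i - 2^-1 = even_part t)//.
  by move: E; rewrite /e; lra.
exists false => k; have [a al ha] := odd_part_digits t k t01.
exists a => //; rewrite -normrN.
rewrite (_ : y ord0 i - 2^-1 = - (t - even_part t)).
  by rewrite mulrN mulNr !opprD !opprK.
by move: E; rewrite /e; lra.
Qed.

Lemma digit_image_bounded n (y : 'rV[R]_n) : packing_image (digit_packing n) y ->
  forall i, `|y ord0 i| <= 2.
Proof.
move=> /packing_imageP[t [/andP[t0 t1] ty]] i.
have [/(_ i) + _] := (cube_boundaryP t _ y t0).1 ty; rewrite mxE.
have /andP[h1 h2] := even_part_bounds t t0.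
by rewrite !ler_norml => /andP[h3 h4]; apply/andP; split; lra.
Qed.

Lemma powR_half_exponent n (z : R) : (0 < n)%N -> 0 < z ->
  z `^ (n%:R - 2^-1) = Num.sqrt z * z ^+ n.-1.
Proof.
case: n => // d _ z0.
rewrite -natr1 (_ : d%:R + 1 - 2^-1 = 2^-1 + d%:R :> R); last by lra.
by rewrite powRD ?powR12_sqrt ?powR_mulrn ?ltW// ?gt_eqF ?implybT.
Qed.

(** The ball meets the image in 2n slabs, one for each coordinate and each of the
    two copies of the Cantor set; each slab needs O(sqrt(rho/r)) centres in the
    special coordinate and O(rho/r) in the n - 1 others. *)
Lemma digit_image_cover n : (0 < n)%N -> exists C : R, 0 < C /\
  forall rho r (x : 'rV[R]_n), 0 < r < rho ->
  (covering_number r (eclosed_ball x rho `&` packing_image (digit_packing n))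
    <= (C * (rho / r) `^ (n%:R - 2^-1))%:E)%E.
Proof.
move=> n0; exists (18 * n%:R * 3 ^+ n.-1).
split; first by rewrite !mulr_gt0 ?exprn_gt0 ?ltr0n.
move=> rho r x /andP[r0 rrho]; set F := _ `&` _.
have rr1 : 1 < rho / r by rewrite ltr_pdivlMr// mul1r.
pose sg (b : bool) : R := if b then 1 else - 2.
have sg1 b : 1 <= `|sg b|.
  by case: b; rewrite /sg ?normr1// normrN ger0_norm// ler1n.
have [cs Hcs] := choice (fun p : 'I_n * bool =>
  digit_set_cover (sg p.2) (x ord0 p.1 - 2^-1) r rho (sg1 p.2) r0 rrho).
pose M := (Num.truncn (2 * rho / r)).+1.
pose Fp (p : 'I_n * bool) := [set y | F y /\ digit_set (sg p.2) (y ord0 p.1 - 2^-1)].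
have cov p : p \in enum [set: 'I_n * bool]%SET ->
    coverable r (size (cs p) * M ^ n.-1) (Fp p).
  move=> _; rewrite -(size_map (fun c => c + 2^-1) (cs p)).
  apply: (coverable_slab r rho x p.1) => //.
    move=> y [[yx _] _] j; apply: le_trans yx; rewrite distrC.
    exact: eucl_dist_coord.
  move=> y [[yx _] Dy]; have [_ /(_ _ Dy)[]] := Hcs p.
    rewrite [_ - _](_ : _ = - (x ord0 p.1 - y ord0 p.1)); last by lra.
    rewrite normrN.
    by apply: le_trans yx; exact: eucl_dist_coord.
  move=> c cc yc; exists (c + 2^-1); first by apply/mapP; exists c.
  by rewrite opprD addrA addrAC.
have := coverable_bigcup r _ _ Fp _ cov.
set m := (\sum_(p <- _) _)%N => covm.
apply: le_trans (covering_number_le _ m _ _) _.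
  apply: (coverable_sub _ _ _ _ _ (leqnn _) _ covm) => y Fy.
  have [i [b Dy]] := digit_image_coord _ _ Fy.2.
  by exists (i, b) => //=; rewrite mem_enum inE.
rewrite lee_fin /m natr_sum big_enum /=.
apply: (@le_trans _ _ (\sum_(p in [set: 'I_n * bool]%SET)
    9 * 3 ^+ n.-1 * (rho / r) `^ (n%:R - 2^-1))).
  apply: ler_sum => p _; rewrite natrM powR_half_exponent ?(lt_trans _ rr1)//.
  rewrite mulrACA -exprMn ler_pM ?ler0n//; first exact: (Hcs p).1.
  rewrite natrX lerXn2r ?nnegrE ?ler0n//; first by lra.
  rewrite /M -natr1.
  have : (Num.truncn (2 * rho / r))%:R <= 2 * rho / r.
    by rewrite truncn_le -mulrA; lra.
  by rewrite -mulrA; lra.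
rewrite sumr_const cardsT card_prod card_ord card_bool -[_ *+ (n * 2)]mulr_natr natrM.
by rewrite le_eqVlt; apply/orP; left; apply/eqP; ring.
Qed.

Lemma digit_image_assouad n : (0 < n)%N ->
  (assouad_dim (packing_image (digit_packing n)) <= (n%:R - 2^-1)%:E)%E.
Proof.
move=> n0; apply: ereal_inf_lbound; exists (n%:R - 2^-1) => //; split.
  by have : 1 <= n%:R :> R; [rewrite ler1n|lra].
have [C [C0 H]] := digit_image_cover n n0.
by exists C; split => // rho r x _ rr _; exact: H.
Qed.

(** The whole image lies in one ball, so this is a special case of
    [digit_image_cover]. *)
Lemma digit_image_box_upper n : (0 < n)%N -> exists C : R, 0 < C /\
  forall r, 0 < r < 1 -> (covering_number r (packing_image (digit_packing n))
    <= (C * r^-1 `^ (n%:R - 2^-1))%:E)%E.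
Proof.
move=> n0; have [C [C0 H]] := digit_image_cover n n0.
have n1 : 1 <= n%:R :> R by rewrite ler1n.
have s0 : 0 < n%:R * 2 :> R by rewrite mulr_gt0// ltr0n.
exists (C * (n%:R * 2) `^ (n%:R - 2^-1)); split.
  by rewrite mulr_gt0// powR_gt0.
move=> r /andP[r0 r1]; have := H (n%:R * 2) r 0.
rewrite (setIidr _); last first.
  move=> y Gy; apply: eucl_dist_le => // i.
  by rewrite mxE sub0r normrN; exact: (digit_image_bounded _ _ Gy).
have ri0 : 0 <= r^-1 by rewrite invr_ge0 ltW.
rewrite (powRM _ (ltW s0) ri0) mulrA; apply.
by rewrite r0; lra.
Qed.

End DigitPacking.

(** * The box dimension of the digit packing *)

Section BoxDimension.
Context {R : realType}.

(** For side t > 1/2 the upper face in the first coordinate contains all points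
    whose other coordinates lie in [1/3, 1/2]. With q = 4^(k+1), the grid
    points of mesh 1/q there, for all 2^(k+1) patterns of even digits, form a
    separated family: the heights of two faces differ by at least
    1/q - 1/(3q). *)
Lemma digit_image_separated d k (r : R) : 4 ^+ k.+1 * r <= 2^-1 ->
  ((2 ^ k.+1 * (Num.truncn ((4 ^+ k.+1 : R) / 6)).+1 ^ d)%:R%:E <=
    covering_number r (packing_image (digit_packing d.+1)))%E.
Proof.
move=> qr; set q : R := 4 ^+ k.+1 in qr *.
have q0 : 0 < q by rewrite exprn_gt0.
set M := (Num.truncn (q / 6)).+1.
have [t Ht] := choice (fun a : 'I_(2 ^ k.+1) =>
  even_part_surj (R := R) k a (ltn_ord a)).
have Mq (m : 'I_M) : m%:R / q <= 6^-1.
  have : m%:R <= q / 6.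
    apply: (@le_trans _ _ (Num.truncn (q / 6))%:R).
      by rewrite ler_nat -ltnS; exact: ltn_ord.
    by rewrite truncn_le; apply: divr_ge0 (ltW q0) _.
  by rewrite ler_pdivrMr// mulrC.
have Mq0 (m : 'I_M) : 0 <= m%:R / q by apply: divr_ge0 (ler0n _ _) (ltW q0).
pose p (z : 'I_(2 ^ k.+1) * {ffun 'I_d -> 'I_M}) : 'rV[R]_d.+1 :=
  \row_j if unlift ord0 j is Some i then 3^-1 + (z.2 i)%:R / q
         else even_part (t z.1) + 2^-1.
apply: covering_number_ge => m cov.
have -> : (2 ^ k.+1 * M ^ d)%N = #|{: 'I_(2 ^ k.+1) * {ffun 'I_d -> 'I_M}}|.
  by rewrite card_prod card_ffun !card_ord.
apply: (separated_leq_cover r m _ _ p _ _ cov).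
  move=> [a h]; have [t2 t1 _] := Ht a; have t0 : 0 < t a by apply: lt_trans t2.
  have /andP[x0 x1] := even_part_bounds _ t0.
  apply/packing_imageP; exists (t a); split; first by rewrite t0.
  apply/cube_boundaryP => //; split; last first.
    exists ord0; rewrite !mxE unlift_none /=.
    by rewrite ger0_norm; lra.
  move=> j; rewrite !mxE; case: unliftP => [i _|_] /=; rewrite ler_norml.
    by have := Mq (h i); have := Mq0 (h i); move=> ? ?; apply/andP; split; lra.
  by apply/andP; split; lra.
have normq y : q * `|y| = `|q * y| by rewrite normrM gtr0_norm.
move=> [a h] [a' h'] neq; have [aa'|aa'] := eqVneq a a'; last first.
  exists ord0; rewrite !mxE unlift_none /= -(ltr_pM2l q0).
  apply: le_lt_trans qr _; rewrite normq.
  have [_ _] := Ht a; have [_ _] := Ht a'; rewrite -/q.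
  have sgap (b b' : 'I_(2 ^ k.+1)) : (b < b')%N ->
      (spread k.+1 b)%:R + 1 <= (spread k.+1 b')%:R :> R.
    move=> bb'; rewrite natr1 ler_nat.
    by have := spread_gap k.+1 b b'; rewrite (ltnW bb') ltn_ord => /(_ isT); lia.
  rewrite mulrBr !mulrDr => /andP[l1 l2] /andP[l3 l4].
  have [alt|alt|/val_inj E] := ltngtP (a : nat) a'; last by rewrite E eqxx in aa'.
    by rewrite ltr_normr; apply/orP; right; have := sgap _ _ alt; lra.
  by rewrite ltr_normr; apply/orP; left; have := sgap _ _ alt; lra.
have [i hi] : exists i, h i != h' i.
  apply/existsP; apply: contraNT neq => /existsPn H; rewrite aa'; apply/eqP; congr pair.
  by apply/ffunP => i; apply/eqP; have := H i; rewrite negbK.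
exists (lift ord0 i); rewrite !mxE liftK /= -(ltr_pM2l q0).
apply: le_lt_trans qr _; rewrite normq.
rewrite opprD addrACA subrr add0r -mulrBl mulrCA divff ?gt_eqF// mulr1.
have ngap (b b' : 'I_M) : (b < b')%N -> (b%:R + 1 <= b'%:R :> R).
  by move=> bb'; rewrite natr1 ler_nat.
have [alt|alt|/val_inj E] := ltngtP (h i : nat) (h' i); last by rewrite E eqxx in hi.
  by rewrite ltr_normr; apply/orP; right; have := ngap _ _ alt; lra.
by rewrite ltr_normr; apply/orP; left; have := ngap _ _ alt; lra.
Qed.

(** The scale k is chosen so that 4^-(k+1) is comparable to r, between 2r and
    8r. *)
Lemma digit_image_box_lower n : (0 < n)%N -> exists c : R, 0 < c /\
  forall r, 0 < r < 32^-1 -> ((c * r^-1 `^ (n%:R - 2^-1))%:E <=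
    covering_number r (packing_image (digit_packing n)))%E.
Proof.
case: n => // d _; exists (Num.sqrt 8^-1 * 48^-1 ^+ d); split.
  by rewrite mulr_gt0 ?exprn_gt0 ?sqrtr_gt0.
move=> r /andP[r0 r32]; have [l [l1 l2]] := exists_scale r r0.
(* As r < 1/32, the scale l is at least 3, and l - 2 is the required one. *)
case: l l1 l2 => [|[|[|k]]]; rewrite ?expr0 ?expr1 ?expr2;
  try by move=> ? ?; exfalso; lra.
move=> l1 [//|l2].
apply: le_trans (digit_image_separated d k r _); last first.
  by move: l2; rewrite 2!exprS; lra.
have {l1 l2} l1 : 8^-1 * r^-1 <= 4 ^+ k.+1.
  by rewrite ler_pdivrMr//; move: l1; rewrite 2!exprS; lra.
have ri0 : 0 < r^-1 by rewrite invr_gt0.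
have q0 : 0 < (4 ^+ k.+1 : R) by rewrite exprn_gt0.
rewrite lee_fin natrM powR_half_exponent// mulrACA -exprMn.
have r48 : 0 <= 48^-1 * r^-1 by rewrite mulr_ge0// ltW.
apply: ler_pM; [by rewrite mulr_ge0 ?sqrtr_ge0|exact: exprn_ge0| |].
  rewrite -sqrtrM// -[(2 ^ k.+1)%:R]ger0_norm// -sqrtr_sqr ler_wsqrtr//.
  by rewrite -!natrX -expnM mulnC expnM natrX.
rewrite natrX lerXn2r ?nnegrE ?mulr_ge0 ?ltW//.
by apply: le_lt_trans (truncnS_gt _); lra.
Qed.

Lemma limf_squeeze (f : R -> \bar R) (F : set_system R) {FF : ProperFilter F} (s : R) :
  (forall e, 0 < e -> F [set r | ((s - e)%:E <= f r <= (s + e)%:E)%E]) ->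
  limf_esup f F = s%:E /\ limf_einf f F = s%:E.
Proof.
move=> H; rewrite limf_einfE limf_esupE.
split; apply/eqP; rewrite eq_le; apply/andP; split.
- apply/lee_addgt0Pr => e e0; apply: ge_ereal_inf.
  exists (ereal_sup (f @` [set r | ((s - e)%:E <= f r <= (s + e)%:E)%E])).
    by exists [set r | ((s - e)%:E <= f r <= (s + e)%:E)%E] => //; exact: H.
  by apply: ge_ereal_sup => _ [r /andP[_ h] <-].
- apply: le_ereal_inf_tmp => _ [V FV <-]; apply/lee_subgt0Pr => e e0.
  have [r [Vr /andP[h _]]] := filter_ex (filterI FV (H e e0)).
  by apply: (le_trans h); apply: ereal_sup_ubound; exists r.
- apply: ge_ereal_sup => _ [V FV <-]; apply/lee_addgt0Pr => e e0.
  have [r [Vr /andP[_ h]]] := filter_ex (filterI FV (H e e0)).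
  by apply: le_trans h; apply: ereal_inf_lbound; exists r.
- apply/lee_subgt0Pr => e e0; apply: le_ereal_sup_tmp.
  exists (ereal_inf (f @` [set r | ((s - e)%:E <= f r <= (s + e)%:E)%E])).
    by exists [set r | ((s - e)%:E <= f r <= (s + e)%:E)%E] => //; exact: H.
  by apply: le_ereal_inf_tmp => _ [r /andP[h _] <-].
Qed.

(** The constants contribute |ln c| / |ln r| to the ratio, which vanishes as r
    tends to 0. *)
Lemma has_box_dim_of_bounds n (F : set 'rV[R]_n) (s c C r0 : R) :
  0 < c -> 0 < C -> 0 < r0 ->
  (forall r, 0 < r < r0 -> ((c * r^-1 `^ s)%:E <= covering_number r F
     <= (C * r^-1 `^ s)%:E)%E) ->
  has_box_dim F s%:E.
Proof.
move=> c0 C0 r00 H; apply: limf_squeeze => e e0.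
pose K := `|ln c| + `|ln C| + 1.
have K0 : 0 < K by rewrite ltr_wpDl.
pose r1 := Num.min r0 (expR (- (K / e))).
have r10 : 0 < r1 by rewrite lt_min r00 expR_gt0.
near=> r.
have rr : 0 < r by near: r; exact: nbhs_right_gt.
have : r < r1 by near: r; exact: nbhs_right_lt.
rewrite lt_min => /andP[rr0 rK].
have L : K / e < - ln r.
  by rewrite -ltrN2 opprK -[ltRHS]expRK ltr_ln ?posrE ?expR_gt0.
have L0 : 0 < - ln r by apply: lt_trans L; rewrite divr_gt0.
have := H r; rewrite rr rr0 => /(_ isT).
case E : (covering_number r F) => [x| |]; rewrite ?leye_eq ?leeNy_eq// ?andbF//.
rewrite !lee_fin => /andP[h1 h2].
have p0 : 0 < r^-1 `^ s by rewrite powR_gt0 ?invr_gt0.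
have x0 : 0 < x by apply: lt_le_trans h1; rewrite mulr_gt0.
rewrite /= /box_ratio E lne_EFin//.
rewrite inver lt_eqF; last by rewrite -oppr_gt0.
rewrite -EFinM -EFinN !lee_fin.
have -> : - (ln x / ln r) = ln x / - ln r by rewrite invrN mulrN.
have lnp : ln (r^-1 `^ s) = s * - ln r by rewrite ln_powR lnV.
rewrite -ler_ln ?posrE ?mulr_gt0// lnM ?posrE// lnp in h1.
rewrite -ler_ln ?posrE ?mulr_gt0// lnM ?posrE// lnp in h2.
rewrite ltr_pdivrMr// in L.
have c1 := ler_norm (- ln c); have C1 := ler_norm (ln C); rewrite normrN in c1.
have c2 := normr_ge0 (ln c); have C2 := normr_ge0 (ln C).
rewrite ler_pdivlMr// ler_pdivrMr// mulrBl mulrDl; rewrite /K in L.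
by apply/andP; split; lra.
Unshelve. all: by end_near. Qed.

Lemma digit_image_box_dim n : (0 < n)%N ->
  has_box_dim (packing_image (digit_packing n)) (n%:R - 2^-1 : R)%:E.
Proof.
move=> n0; have [c [c0 Hc]] := digit_image_box_lower n n0.
have [C [C0 HC]] := digit_image_box_upper (R := R) n n0.
apply: (has_box_dim_of_bounds _ _ (n%:R - 2^-1) c C 32^-1 c0 C0) => [|r /andP[r0 r1]].
  by rewrite invr_gt0.
rewrite Hc ?r0//= HC// r0 /=; apply: lt_trans r1 _; rewrite invf_lt1//; lra.
Qed.

End BoxDimension.

(** * Upper bounds for the Hausdorff premeasure *)

Section HausdorffUpper.
Context {R : realType} {n : nat}.
Implicit Types (s delta r : R) (F U : set 'rV[R]_n).

Lemma diam_pow_ge0 s U : (0 <= diam_pow s U)%E.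
Proof. by rewrite /diam_pow; case: ifP => // _; exact: poweR_ge0. Qed.

(** Doubly indexed covers are allowed: a bijection between nat and nat * nat
    turns the double series of nonnegative terms into a single one. *)
Lemma hausdorff_premeasure_bigcup s delta F (G : nat -> nat -> set 'rV[R]_n) :
  (forall k l, (ediam (G k l) <= delta%:E)%E) ->
  F `<=` \bigcup_k \bigcup_l G k l ->
  (hausdorff_premeasure s delta F
    <= \sum_(0 <= k <oo) \sum_(0 <= l <oo) diam_pow s (G k l))%E.
Proof.
move=> Gdelta FG; have /card_esym/ppcard_eqP[f] := card_nat2.
rewrite (_ : (\sum_(0 <= k <oo) _)%E =
    (\sum_(0 <= k <oo) diam_pow s ((uncurry G \o f) k))%E).
  apply: ereal_inf_lbound; exists (uncurry G \o f) => //; split => [k|x /FG].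
    by rewrite /= /uncurry; case: (f k).
  move=> [k _ [l _ Gx]]; exists (f^-1%FUN (k, l)) => //=.
  by rewrite invK ?inE.
rewrite [RHS]nneseries_esumT; last by move=> k; exact: diam_pow_ge0.
rewrite -(reindex_esum [set: nat] [set: nat * nat] f
  (fun z => diam_pow s (uncurry G z))); last exact: bij.
rewrite (_ : [set: nat * nat] = [set: nat] `*`` (fun=> [set: nat])); last first.
  by apply/seteqP; split.
rewrite (eq_esum (b := fun z => diam_pow s (G z.1 z.2))); last by move=> [].
rewrite -(esum_esum (a := fun k l => diam_pow s (G k l))); last first.
  by move=> *; exact: diam_pow_ge0.
rewrite nneseries_esumT; last first.
  by move=> k; apply: nneseries_ge0 => l _ _; exact: diam_pow_ge0.
apply: eq_esum => k _; rewrite nneseries_esumT// => l; exact: diam_pow_ge0.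
Qed.

Lemma ediam_ge0 U x : U x -> (0 <= ediam U)%E.
Proof.
move=> Ux; apply: (@le_trans _ _ (eucl_dist x x)%:E).
  by rewrite lee_fin sqrtr_ge0.
by apply: ereal_sup_ubound; exists x => //; exists x.
Qed.

Lemma ediam_cube r (c : 'rV[R]_n) : 0 <= r -> (ediam (cube r c) <= (n%:R * r)%:E)%E.
Proof.
move=> r0; apply: ge_ereal_sup => _ [x xc [y yc <-]].
rewrite lee_fin; apply: eucl_dist_le => // i.
have /andP[a1 a2] := xc i; have /andP[b1 b2] := yc i.
by rewrite ler_norml; apply/andP; split; lra.
Qed.

Lemma diam_pow_cube s r (c : 'rV[R]_n) : 0 <= s -> 0 <= r ->
  (diam_pow s (cube r c) <= ((n%:R * r) `^ s)%:E)%E.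
Proof.
move=> s0 r0; rewrite /diam_pow; case: ifP => [_|_]; first by rewrite lee_fin powR_ge0.
have cc : cube r c c by move=> i; apply/andP; split; lra.
rewrite -poweR_EFin; apply: gt0_ler_poweR => //.
- by rewrite in_itv /= (ediam_ge0 _ c)//= leey.
- by rewrite in_itv /= lee_fin mulr_ge0//= leey.
exact: ediam_cube.
Qed.

Lemma hausdorff_premeasure_covers s delta F (Fk : nat -> set 'rV[R]_n)
    (m : nat -> nat) (r : nat -> R) :
  0 <= s -> 0 <= delta -> (forall k, 0 <= r k) -> (forall k, n%:R * r k <= delta) ->
  F `<=` \bigcup_k Fk k -> (forall k, coverable (r k) (m k) (Fk k)) ->
  (hausdorff_premeasure s delta F
    <= \sum_(0 <= k <oo) ((m k)%:R * (n%:R * r k) `^ s)%:E)%E.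
Proof.
move=> s0 d0 r0 rdelta FF cov; have [c Hc] := choice cov.
pose G k l := if (l < size (c k))%N then cube (r k) (nth 0 (c k) l) else set0.
apply: le_trans (hausdorff_premeasure_bigcup s delta F G _ _) _.
- move=> k l; rewrite /G; case: ifP => _.
    by apply: le_trans (ediam_cube _ _ _) _; rewrite ?lee_fin.
  by apply: ge_ereal_sup => _ [x []].
- move=> x /FF[k _ /(Hc k).2[a ac xa]]; exists k => //; exists (index a (c k)) => //.
  by rewrite /G index_mem ac nth_index.
apply: lee_nneseries => k _.
  by move=> _; apply: nneseries_ge0 => l _ _; exact: diam_pow_ge0.
apply: lime_le; first by apply: is_cvg_nneseries => l _ _; exact: diam_pow_ge0.
apply: nearW => N; set b := (n%:R * r k) `^ s.
apply: (@le_trans _ _ (\sum_(0 <= l < N) (if (l < size (c k))%N then b else 0)%:E)%E).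
  apply: lee_sum => l _; rewrite /G; case: ifP => _; first exact: diam_pow_cube.
  by rewrite /diam_pow eqxx.
rewrite sumEFin lee_fin -big_mkcond /= big_const_seq iter_addr_0 -[b *+ _]mulr_natl.
apply: ler_wpM2r; first exact: powR_ge0.
rewrite ler_nat; apply: leq_trans (Hc k).1.
rewrite -size_filter -[leqRHS](size_iota 0); apply: uniq_leq_size.
  by rewrite filter_uniq// iota_uniq.
by move=> l; rewrite mem_filter !mem_iota /= => /andP[->].
Qed.

End HausdorffUpper.

(** * Reals very close to rationals at every scale *)

Section RationallyApproximable.
Context {R : realType}.

Definition rat_enum (k : nat) : R := ratr (odflt 0 (choice.unpickle k)).

(** For every s > 0 the series over k of (rat_radius m k)^s is O(2^-m) once
    m s >= 1. This is what makes the set of reals within these distances of the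
    rationals, for all m, have Hausdorff dimension 0. *)
Definition rat_radius (m k : nat) : R := 2^-1 ^+ ((k + m) * m).

Definition near_rat (m : nat) : set R :=
  [set u | exists k, `|u - rat_enum k| < rat_radius m k / 2].

Lemma rat_radius_gt0 m k : 0 < rat_radius m k.
Proof. by rewrite exprn_gt0. Qed.

Lemma near_rat_shift_open_dense m (c : R) :
  open [set g : R | near_rat m (g + c)] /\ dense [set g : R | near_rat m (g + c)].
Proof.
split.
  rewrite openE => g [k gk]; apply/nbhs_ballP.
  exists (rat_radius m k / 2 - `|g + c - rat_enum k|); first by rewrite /= subr_gt0.
  move=> h; rewrite /ball /= => gh; exists k.
  have := ler_normD (h - g) (g + c - rat_enum k).
  rewrite distrC addrA (_ : h - g + (g + c) = h + c); last by lra.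
  by rewrite distrC in gh *; lra.
move=> O [g Og] oO; have := oO; rewrite openE => /(_ g Og) /nbhs_ballP[e /= e0 ge].
have [|q] := @rat_in_itvoo R (g + c - e) (g + c + e); first by lra.
rewrite in_itv /= => /andP[q1 q2]; exists (ratr q - c); split.
  by apply: ge; rewrite /ball /= ltr_norml; apply/andP; split; lra.
exists (choice.pickle q); rewrite /rat_enum choice.pickleK /= subrK subrr normr0.
by rewrite divr_gt0// rat_radius_gt0.
Qed.

Lemma exists_near_rat_pair (t : R) : exists g, 0 < g < 1 /\
  forall m, near_rat m (g + t / 2) /\ near_rat m (g - t / 2).
Proof.
pose W m : set R :=
  [set g | near_rat m (g + t / 2)] `&` [set g | near_rat m (g + - (t / 2))].
have [|||g [g01 Wg]] := @Baire R R W _ `]0, 1[%classic.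
- move=> m; have [ op1 d1] := near_rat_shift_open_dense m (t / 2).
  have [ op2 d2] := near_rat_shift_open_dense m (- (t / 2)).
  by split; [exact: openI|exact: denseI].
- by exists (2^-1); rewrite /= in_itv /=; apply/andP; split; lra.
- exact: itv_open.
exists g; split; first by move: g01; rewrite /= in_itv.
by move=> m; have := Wg m I.
Qed.

(** Cover the slab of thickness r around the k-th rational height by about
    r^-(n-1) cubes of side r. They contribute O(r^(s-n+1)) to the premeasure, and
    the choice of [rat_radius] makes the sum over k arbitrarily small. *)
Lemma near_rat_hausdorff_measure0 n (G : set 'rV[R]_n) s : (0 < n)%N ->
  (forall y, G y -> forall i, `|y ord0 i| <= 2) ->
  (forall y, G y -> forall m, exists i, near_rat m (y ord0 i)) ->
  n%:R - 1 < s -> hausdorff_measure s G = 0%E.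
Proof.
move=> n0 G2 Gnear ns.
have n1 : 1 <= n%:R :> R by rewrite ler1n.
have s0 : 0 <= s by lra.
have half_itv : 0 < (2^-1 : R) <= 1 by apply/andP; split; lra.
suff small delta eta : 0 < delta -> 0 < eta ->
    (hausdorff_premeasure s delta G <= eta%:E)%E.
  apply/eqP; rewrite eq_le; apply/andP; split.
    apply: ge_ereal_sup => _ [delta /= d0 <-]; apply/lee_addgt0Pr => e e0.
    by rewrite add0e; exact: small.
  apply: (@le_trans _ _ (hausdorff_premeasure s 1 G)).
    apply: le_ereal_inf_tmp => _ [U _ <-].
    by apply: nneseries_ge0 => k _ _; exact: diam_pow_ge0.
  by apply: ereal_sup_ubound; exists 1 => //=.
move=> delta0 eta0.
pose sigma := s - (n%:R - 1); have sigma0 : 0 < sigma by rewrite subr_gt0.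
pose K : R := n%:R * 5 ^+ n.-1 * n%:R `^ s.
have K0 : 0 < K by rewrite !mulr_gt0 ?exprn_gt0 ?powR_gt0 ?ltr0n.
(* Large m makes the exponent m * sigma at least 1, the cubes smaller than delta
   and the total contribution 2 * K / 2 ^ m smaller than eta. *)
pose m :=
  (Num.truncn (sigma^-1) + Num.truncn (n%:R / delta) + Num.truncn (2 * K / eta)).+1.
have truncm (z : R) : (Num.truncn z < m)%N -> z <= m%:R.
  by move=> zl; rewrite ltW// (lt_le_trans (truncnS_gt z))// ler_nat.
have pow2 : m%:R <= 2 ^+ m :> R by rewrite -natrX ler_nat ltnW// ltn_expl.
have m_sigma : 1 <= m%:R * sigma.
  by rewrite -ler_pdivrMr// mul1r; apply: truncm; rewrite ltnS -addnA leq_addr.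
have m_delta : n%:R * 2^-1 ^+ m <= delta.
  rewrite exprVn ler_pdivrMr ?exprn_gt0// mulrC -ler_pdivrMr//.
  by apply: le_trans pow2; apply: truncm; rewrite ltnS -addnA addnCA leq_addr.
have m_eta : 2 * K * 2^-1 ^+ m <= eta.
  rewrite exprVn ler_pdivrMr ?exprn_gt0// [eta * _]mulrC -ler_pdivrMr//.
  by apply: le_trans pow2; apply: truncm; rewrite ltnS leq_addl.
have m0 : (0 < m)%N by [].
clearbody m; clear truncm pow2.
have half0 : 0 <= 2^-1 :> R by [].
have half1 : 2^-1 <= 1 :> R by rewrite invf_le1// ler1n.
pose r k := rat_radius m k.
have r0 k : 0 < r k by exact: rat_radius_gt0.
have rle k : r k <= 2^-1 ^+ (k + m).
  by apply: ler_wiXn2l => //; rewrite leq_pmulr.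
pose M k := (Num.truncn (2 * 2 / r k)).+1.
pose Fi k i := [set y | G y /\ `|y ord0 i - rat_enum k| <= r k / 2].
have cov k : coverable (r k) (\sum_(i <- enum 'I_n) (1 * M k ^ n.-1))
    (\bigcup_(i in [set` enum 'I_n]) Fi k i).
  apply: coverable_bigcup => i _.
  apply: (coverable_slab (r k) 2 0 i [:: rat_enum k]) => //.
    by move=> y [Gy _] j; rewrite mxE subr0; exact: G2.
  by move=> y [_ yk]; exists (rat_enum k) => //; rewrite inE.
have r_delta k : n%:R * r k <= delta.
  apply: le_trans m_delta; apply: ler_wpM2l => //; apply: le_trans (rle k) _.
  by apply: ler_wiXn2l => //; rewrite leq_addl.
have r1 k : r k <= 1.
  by apply: le_trans (rle k) _; apply: exprn_ile1.
apply: le_trans (hausdorff_premeasure_covers s delta G _ _ r s0 (ltW delta0)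
  (fun k => ltW (r0 k)) r_delta _ cov) _.
  move=> y Gy; have [i [k yk]] := Gnear y Gy m.
  by exists k => //; exists i; rewrite /= ?mem_enum//; split => //; exact: ltW.
apply: le_trans (epsilon_trick0 xpredT (ltW eta0)).
apply: lee_nneseries => k _; first by rewrite lee_fin mulr_ge0// powR_ge0.
rewrite lee_fin big_enum /= sum_nat_const card_ord mul1n natrM natrX.
have Mle : (M k)%:R <= 5 / r k.
  rewrite /M -natr1.
  have : (Num.truncn (2 * 2 / r k))%:R <= 2 * 2 / r k.
    by rewrite truncn_le; apply: divr_ge0 (ltW (r0 k)).
  have : 1 <= (r k)^-1 by rewrite invf_ge1.
  lra.
apply: (@le_trans _ _ (K * r k `^ sigma)).
  rewrite /K -!mulrA; apply: ler_wpM2l => //.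
  apply: (@le_trans _ _ ((5 / r k) ^+ n.-1 * (n%:R * r k) `^ s)).
    apply: ler_wpM2r; first exact: powR_ge0.
    by rewrite lerXn2r ?nnegrE// (le_trans _ Mle).
  have -> : s = n.-1%:R + sigma.
    by rewrite /sigma -[in n%:R - 1](prednK n0) -natr1; lra.
  rewrite exprMn -!mulrA ler_wpM2l ?exprn_ge0//.
  rewrite (powRM _ (ler0n _ _) (ltW (r0 k))) mulrCA ler_wpM2l ?powR_ge0//.
  rewrite powRD; last by rewrite (gt_eqF (r0 k)) implybT.
  rewrite powR_mulrn; last exact: ltW.
  rewrite mulrA -exprMn mulVf ?gt_eqF//.
  by rewrite expr1n mul1r.
have -> : r k `^ sigma = 2^-1 `^ ((k + m)%:R * (m%:R * sigma)).
  by rewrite /r /rat_radius -powR_mulrn// -powRrM natrM mulrA.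
apply: (@le_trans _ _ (K * 2^-1 ^+ (k + m))).
  apply: ler_wpM2l; first exact: ltW.
  by rewrite -[leRHS]powR_mulrn//; apply: ger_powR => //; rewrite ler_peMr.
rewrite natrX exprD exprS invfM -exprVn.
have h0 : 0 <= 2^-1 ^+ k :> R by rewrite exprn_ge0.
have := ler_wpM2r h0 m_eta; lra.
Qed.

End RationallyApproximable.

(** * Lower bound for the Hausdorff dimension *)

Section HausdorffLower.
Context {R : realType} {d : nat}.

Definition upper_face (t : R) (x : 'rV[R]_d.+1) : set 'rV[R]_d.+1 :=
  [set y | y ord0 ord0 = x ord0 ord0 + t / 2 /\
           forall i, `|y ord0 i - x ord0 i| <= t / 2].

Lemma upper_face_sub t x : 0 < t -> upper_face t x `<=` cube_boundary t x.
Proof.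
move=> t0 y [y0 yi]; apply/cube_boundaryP => //; split => //; exists ord0.
by rewrite y0 addrAC subrr add0r ger0_norm// divr_ge0// ltW.
Qed.

Lemma upper_face_compact t x : compact (upper_face t x).
Proof.
pose A (i : 'I_d.+1) : set R := if i == ord0 then [set x ord0 ord0 + t / 2]
  else `[x ord0 i - t / 2, x ord0 i + t / 2]%classic.
have : compact [set y : 'rV[R]_d.+1 | forall i, A i (y ord0 i)].
  apply: rV_compact => i; rewrite /A; case: ifP => _; first exact: compact_set1.
  exact: segment_compact.
have [t0|t0] := leP 0 t; last first.
  move=> _; rewrite (_ : upper_face t x = set0); first exact: compact0.
  apply/seteqP; split => // y [_ /(_ ord0)]; rewrite leNgt => /negP[].
  by rewrite (lt_le_trans _ (normr_ge0 _))// pmulr_llt0.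
congr compact; apply/seteqP; split => y /=.
  move=> Ay; have y0 := Ay ord0; rewrite /A eqxx /= in y0; split => // i.
  have [->|i0] := eqVneq i ord0.
    by rewrite y0 addrAC subrr add0r ger0_norm// divr_ge0.
  have := Ay i; rewrite /A (negbTE i0) /= in_itv /= ler_norml => /andP[h1 h2].
  by apply/andP; split; lra.
move=> [y0 yi] i; rewrite /A; case: eqVneq => [->//|_] /=.
have := yi i; rewrite ler_norml in_itv /= => /andP[h1 h2].
by apply/andP; split; lra.
Qed.

(** The grid of mesh 2r on the face is r-separated. *)
Lemma upper_face_covering_lower t x r m : 0 < r -> 0 < t ->
  coverable r m (upper_face t x) -> (t / (2 * r)) ^+ d <= m%:R :> R.
Proof.
move=> r0 t0 cov; pose M := (Num.truncn (t / (2 * r))).+1.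
have r2 : 0 < 2 * r by rewrite mulr_gt0.
pose p (h : {ffun 'I_d -> 'I_M}) : 'rV[R]_d.+1 :=
  \row_j if unlift ord0 j is Some i then x ord0 j - t / 2 + (h i)%:R * (2 * r)
         else x ord0 ord0 + t / 2.
have le_m : (M ^ d <= m)%N.
  rewrite -[M in (M ^ d)%N](card_ord M) -[d in (_ ^ d)%N](card_ord d) -card_ffun.
  apply: (separated_leq_cover r m _ _ p _ _ cov).
    move=> h; split; first by rewrite mxE unlift_none.
    move=> j; rewrite mxE; case: unliftP => [i _|->]; last first.
      by rewrite addrAC subrr add0r ger0_norm// divr_ge0// ltW.
    have h0 : 0 <= (h i)%:R * (2 * r) by apply: mulr_ge0 => //; exact: ltW.
    have : (h i)%:R * (2 * r) <= t.
      rewrite -ler_pdivlMr//; apply: (@le_trans _ _ (Num.truncn (t / (2 * r)))%:R).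
        by rewrite ler_nat -ltnS; exact: ltn_ord.
      by rewrite truncn_le; apply: divr_ge0; exact: ltW.
    by move=> h1; rewrite ler_norml; apply/andP; split; lra.
  move=> h h' neq.
  have [i hi] : exists i, h i != h' i.
    apply/existsP; apply: contraNT neq => /existsPn H; apply/eqP/ffunP => i.
    by apply/eqP; have := H i; rewrite negbK.
  exists (lift ord0 i); rewrite !mxE liftK.
  have gap (b b' : 'I_M) : (b < b')%N -> b%:R * (2 * r) + 2 * r <= b'%:R * (2 * r).
    move=> bb'; rewrite -[X in _ + X]mul1r -mulrDl natr1 ler_pM2r//.
    by rewrite ler_nat.
  have [alt|alt|/val_inj E] := ltngtP (h i : nat) (h' i); last by rewrite E eqxx in hi.
    by rewrite ltr_normr; apply/orP; right; have := gap _ _ alt; lra.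
  by rewrite ltr_normr; apply/orP; left; have := gap _ _ alt; lra.
apply: (@le_trans _ _ (M%:R ^+ d)); last by rewrite -natrX ler_nat.
rewrite lerXn2r ?nnegrE//; last by rewrite ltW// truncnS_gt.
by apply: divr_ge0; exact: ltW.
Qed.

Lemma exprD_le (a b : R) : 0 <= a -> 0 <= b ->
  (a + b) ^+ d <= 2 ^+ d * (a ^+ d + b ^+ d).
Proof.
move=> a0 b0; have m0 : 0 <= Num.max a b by rewrite le_max a0.
apply: (@le_trans _ _ ((2 * Num.max a b) ^+ d)).
  rewrite lerXn2r ?nnegrE ?addr_ge0 ?mulr_ge0// mulr_natl mulr2n.
  by rewrite lerD// le_max lexx ?orbT.
rewrite exprMn ler_wpM2l ?exprn_ge0//.
by have [_|_] := leP a b; rewrite ?lerDl ?lerDr exprn_ge0.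
Qed.

Lemma exprn_le_powR (a s : R) : (0 < d)%N -> 0 <= a <= 1 -> s <= d%:R ->
  a ^+ d <= a `^ s.
Proof.
move=> d0 /andP[a0 a1] sd; move: a0; rewrite le_eqVlt => /predU1P[<-|a0].
  by rewrite expr0n gtn_eqF// powR_ge0.
by rewrite -powR_mulrn ?(ltW a0)//; apply: ger_powR => //; rewrite a0.
Qed.

(** Choose r below all the radii. Then the ball of radius e k is covered by at most
    (3 e k / r)^d cubes of side r, whereas the face needs at least (t / 2r)^d of
    them; r cancels. *)
Lemma upper_face_ball_cover t x (I : eqType) (D : seq I)
    (u : I -> 'rV[R]_d.+1) (e : I -> R) : 0 < t ->
  (forall k, 0 < e k) ->
  upper_face t x `<=` \bigcup_(k in [set` D]) ball (u k) (e k) ->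
  (t / 6) ^+ d <= \sum_(k <- D) e k ^+ d.
Proof.
move=> t0 e0 cov.
have [r r0 re] : exists2 r, 0 < r & forall k, k \in D -> r <= e k.
  elim: (D) => [|k D' [r r0 re]]; first by exists 1.
  exists (Num.min (e k) r); first by rewrite lt_min e0.
  by move=> j; rewrite inE ge_min => /predU1P[->|/re ->]; rewrite ?lexx ?orbT.
pose M k := (Num.truncn (2 * e k / r)).+1.
pose Fk k := upper_face t x `&` ball (u k) (e k).
have covk k : k \in D -> coverable r (1 * M k ^ d) (Fk k).
  move=> _; apply: (coverable_slab r (e k) (u k) ord0 [:: x ord0 ord0 + t / 2]) => //.
    move=> y [_ /rV_ballE yu] j; rewrite distrC ltW//; exact: yu.
  move=> y [[y0 _] _]; exists (x ord0 ord0 + t / 2); first by rewrite inE.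
  by rewrite y0 subrr normr0 divr_ge0// ltW.
have covD := coverable_bigcup r _ D Fk _ covk.
have covF : coverable r (\sum_(k <- D) 1 * M k ^ d) (upper_face t x).
  apply: coverable_sub (leqnn _) _ covD => y Fy.
  by have [k kD yk] := cov y Fy; exists k.
have := upper_face_covering_lower t x r _ r0 t0 covF.
rewrite natr_sum => le1.
have le2 : (t / (2 * r)) ^+ d <= \sum_(k <- D) (3 / r) ^+ d * e k ^+ d.
  apply: le_trans le1 _; rewrite big_seq [leRHS]big_seq; apply: ler_sum => k kD.
  rewrite mul1n natrX -exprMn.
  have rk : 0 < e k / r by rewrite divr_gt0.
  rewrite lerXn2r ?nnegrE//; first by rewrite mulrAC -mulrA mulr_ge0// ltW.
  have : (Num.truncn (2 * e k / r))%:R <= 2 * e k / r.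
    by rewrite truncn_le -mulrA mulr_ge0// ltW.
  have : 1 <= e k / r by rewrite ler_pdivlMr// mul1r re.
  by rewrite /M -natr1 mulrAC -!mulrA; lra.
rewrite -mulr_sumr in le2.
have r3 : 0 < (3 / r) ^+ d by rewrite exprn_gt0// divr_gt0.
rewrite -(ler_pM2l r3); apply: le_trans le2; rewrite -exprMn.
by rewrite le_eqVlt; apply/orP; left; apply/eqP; congr (_ ^+ d); field; rewrite gt_eqF.
Qed.

(** From a cover with a small sum, enlarge each set to an open ball whose radius
    exceeds its diameter by eps k, with a small total excess, and extract a
    finite subcover of the compact face: the sum of the d-th powers of the radii
    is then too small for [upper_face_ball_cover]. *)
Lemma upper_face_hausdorff_measure t x s F : (0 < d)%N -> 0 < t ->
  upper_face t x `<=` F -> 0 <= s -> s < d%:R -> hausdorff_measure s F <> 0%E.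
Proof.
move=> d0 t0 faceF s0 sd H0.
(* The radii e k below satisfy sum_k e k ^ d <= 2 ^ d * (2 * eta); the bound 1 on
   eta is for eps k ^ d <= eps k. *)
pose eta : R := Num.min 1 ((t / 12) ^+ d / 4).
have t12 : 0 < (t / 12) ^+ d by rewrite exprn_gt0// divr_gt0.
have eta0 : 0 < eta by rewrite lt_min ltr01 divr_gt0.
have : (hausdorff_premeasure s 1 F < eta%:E)%E.
  apply: (@le_lt_trans _ _ 0%E); last by rewrite lte_fin.
  by rewrite -H0; apply: ereal_sup_ubound; exists 1 => //=.
move=> /ereal_inf_lt[_ [U [Udiam FU] <-]] Ueta.
pose diam k : R := if U k == set0 then 0 else fine (ediam (U k)).
pose eps k : R := eta / (2 ^ k.+1)%:R.
have eps0 k : 0 < eps k by rewrite divr_gt0// ltr0n expn_gt0.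
have eps1 k : eps k <= 1.
  rewrite ler_pdivrMr ?ltr0n ?expn_gt0// mul1r (@le_trans _ _ 1)//.
    by rewrite ge_min lexx.
  by rewrite ler1n expn_gt0.
have ediamE k y : U k y -> ediam (U k) = (diam k)%:E.
  move=> Uy; rewrite /diam; case: eqP => [U0|_]; first by rewrite U0 in Uy.
  rewrite fineK// fin_real// (lt_le_trans _ (ediam_ge0 _ _ Uy))//=.
  by rewrite (le_lt_trans (Udiam k))// ltry.
have diam01 k : 0 <= diam k <= 1.
  have [U0|/set0P[y Uy]] := eqVneq (U k) set0.
    by rewrite /diam U0 eqxx lexx ler01.
  have := ediam_ge0 _ _ Uy; have := Udiam k.
  by rewrite (ediamE _ _ Uy) !lee_fin => -> ->.
have diam_pow_ge k : ((diam k ^+ d)%:E <= diam_pow s (U k))%E.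
  have [U0|/set0P[y Uy]] := eqVneq (U k) set0.
    by rewrite /diam /diam_pow U0 eqxx expr0n gtn_eqF.
  rewrite /diam_pow; case: eqP => [U0|_]; first by rewrite U0 in Uy.
  rewrite (ediamE _ _ Uy) poweR_EFin lee_fin.
  by apply: exprn_le_powR => //; exact: ltW.
have [u Hu] : {u : nat -> 'rV[R]_d.+1 | forall k, U k !=set0 -> U k (u k)}.
  by exists (fun k => get (U k)) => k [y Uy]; exact: (getI Uy).
pose e k := diam k + eps k.
have e0 k : 0 < e k by have /andP[h _] := diam01 k; rewrite ltr_wpDl.
have cov : upper_face t x `<=` cover [set: nat] (fun k => ball (u k) (e k)).
  move=> y /faceF/FU[k _ Uy]; exists k => //; apply/rV_ballE => // i.
  apply: (@le_lt_trans _ _ (diam k)); last by rewrite ltrDl.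
  apply: le_trans (eucl_dist_coord _ _ _ _) _; rewrite -lee_fin -(ediamE _ _ Uy).
  apply: ereal_sup_ubound; exists (u k); first by apply: Hu; exists y.
  by exists y.
have := upper_face_compact t x; rewrite compact_cover => /(_ nat setT _ _ cov)[].
  by move=> k _; exact: ball_open.
move=> D _ covD; have := upper_face_ball_cover t x _ (enum_fset D) u e t0 e0 covD.
apply/negP; rewrite -ltNge.
have sum1 : \sum_(k <- enum_fset D) diam k ^+ d <= eta.
  rewrite -lee_fin -sumEFin; apply: le_trans (ltW Ueta).
  apply: le_trans (lee_sum_fset_lim D xpredT _); last first.
    by move=> k _; exact: diam_pow_ge0.
  by apply: lee_sum => k _; exact: diam_pow_ge.
have sum2 : \sum_(k <- enum_fset D) eps k <= eta.
  rewrite -lee_fin -sumEFin; apply: le_trans (epsilon_trick0 xpredT (ltW eta0)).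
  by apply: (lee_sum_fset_lim D xpredT) => k _; rewrite lee_fin ltW// eps0.
apply: (@le_lt_trans _ _ (\sum_(k <- enum_fset D) 2 ^+ d * (diam k ^+ d + eps k))).
  apply: ler_sum => k _; have /andP[h0 _] := diam01 k.
  apply: le_trans (exprD_le _ _ h0 (ltW (eps0 k))) _.
  rewrite ler_wpM2l ?exprn_ge0// lerD2l.
  by apply: ler_iXnr => //; exact: ltW.
rewrite -mulr_sumr big_split /=.
rewrite (_ : t / 6 = 2 * (t / 12)); last by lra.
rewrite exprMn ltr_pM2l ?exprn_gt0//.
have : eta <= (t / 12) ^+ d / 4 by rewrite ge_min lexx orbT.
lra.
Qed.

Lemma hausdorff_dim_packing_ge (f : R -> 'rV[R]_d.+1) : (0 < d)%N ->
  (d%:R%:E <= hausdorff_dim (packing_image f))%E.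
Proof.
move=> d0; apply: le_ereal_inf_tmp => _ [s [s0 H0] <-].
rewrite lee_fin leNgt; apply/negP => sd.
have h2 : 0 < 2^-1 :> R by [].
apply: (upper_face_hausdorff_measure 2^-1 (f 2^-1) s _ d0 h2 _ s0 sd H0).
move=> y /(upper_face_sub _ _ h2) fy; apply/packing_imageP; exists 2^-1.
by split=> //; apply/andP; split; lra.
Qed.

End HausdorffLower.

(** * The three packings *)

Theorem theorem1p4 (R : realType) (n : nat) (hn : (2 <= n)%N)
    (eps : R) (heps : 0 < eps) :
  exists f1 f2 f3 : R -> 'rV[R]_n,
    [/\ size_cube_packing f1, size_cube_packing f2 & size_cube_packing f3] /\
    [/\ hausdorff_dim (packing_image f1) = (n%:R - 1)%:E,
        has_box_dim (packing_image f2) (n%:R - 2^-1)%:E &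
        (assouad_dim (packing_image f3) <= (n%:R - 2^-1 + eps)%:E)%E].
Proof.
case: n hn => [//|[//|d]] _.
have [g Hg] := choice (@exists_near_rat_pair R).
exists (fun t => \row__ g t), (digit_packing _), (digit_packing _); split; split.
- by move=> t _ i; rewrite mxE; have [/andP[h1 h2] _] := Hg t; rewrite !ltW.
- exact: digit_packing_size.
- exact: digit_packing_size.
- apply/eqP; rewrite eq_le; apply/andP; split; last first.
    by rewrite -[X in (X - 1)%:E]natr1 addrK; exact: hausdorff_dim_packing_ge.
  apply/lee_addgt0Pr => e e0; apply: ereal_inf_lbound.
  exists (d.+2%:R - 1 + e) => //; split.
    by rewrite -natr1 addrK addr_ge0// ltW.
  apply: near_rat_hausdorff_measure0 => //; last by rewrite ltrDl.
    move=> y /packing_imageP[t [/andP[t0 t1] ty]] i.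
    have [/(_ i) + _] := (cube_boundaryP t _ y t0).1 ty; rewrite mxE.
    have [/andP[h1 h2] _] := Hg t.
    by rewrite !ler_norml => /andP[h3 h4]; apply/andP; split; lra.
  move=> y /packing_imageP[t [/andP[t0 t1] ty]] m.
  have [_ [i]] := (cube_boundaryP t _ y t0).1 ty; rewrite mxE.
  have [_ /(_ m)[n1 n2]] := Hg t.
  set z := y ord0 i - _; have [z0|z0] := ger0P z => E; exists i.
    by rewrite (_ : y ord0 i = g t + t / 2)//; rewrite -E /z; lra.
  by rewrite (_ : y ord0 i = g t - t / 2)//; rewrite -E /z; lra.
- exact: digit_image_box_dim.
- apply: le_trans (digit_image_assouad _ _) _ => //.
  by rewrite lee_fin lerDl ltW.
Qed.
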